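(* Let $(A,\mathfrak m)$ be a Cohen-Macaulay local ring of dimension $d$ and let $I$ be a proper ideal of $A$. Set $m=\mu(I)$ and $g=\operatorname{grade}(I)$, and assume $m>g$. Set $c=\min\{\operatorname{depth}H_i(I): 0\le i<m-g\}$. Then (1) $\operatorname{depth}H_{m-g}(I)\ge c$; (2) if $c<d-g$ then $\operatorname{depth}H_{m-g}(I)\ge c+1$.
   Context: $\mu(I)$ is the minimal number of generators of $I$; $\operatorname{grade}(I)$ is the length of a maximal $A$-regular sequence in $I$. $H_i(I)$ is the $i$-th Koszul homology module (coefficients in $A$) of a minimal generating set of $I$ (independent, up to isomorphism, of the choice). *)

(* Defs.v *)
From HB Require Import structures.
From mathcomp Require Import all_boot all_order all_algebra.
From mathcomp Require Import generic_quotient ring_quotient.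
From mathcomp Require Import ring.
From mathcomp Require Import boolp classical_sets constructive_ereal.

Set Implicit Arguments.
Unset Strict Implicit.
Unset Printing Implicit Defensive.
Import Order.TTheory GRing.Theory Num.Theory.
Local Open Scope ring_scope.

(* Ideals are boolean predicates {pred A}, as in ring_quotient; since boolp    *)
(* makes every proposition decidable, this covers all ideals. Beware that      *)
(* [idealr_closed I] includes 1 \notin I: it means "I is a proper ideal".      *)

(* Numerical invariants take values in \bar int (integers with -oo and +oo).   *)
Definition sup_nat (P : nat -> Prop) : \bar int :=
  supremum -oo%E [set e | exists2 n : nat, P n & e = (n%:Z)%:E].

Section Ideals.
Variable A : comNzRingType.

Definition generates (n : nat) (x : 'I_n -> A) (I : {pred A}) : Prop :=
  forall y, y \in I <-> exists a : 'I_n -> A, y = \sum_i a i * x i.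

Definition mu (I : {pred A}) : nat :=
  infimum 0%N [set n | exists x : 'I_n -> A, generates x I].

(* The unit ideal is left out, being generated by 1. *)
Definition noetherian : Prop :=
  forall I : {pred A}, idealr_closed I ->
    exists (n : nat) (x : 'I_n -> A), generates x I.

Definition maximal_ideal (M : {pred A}) : Prop :=
  idealr_closed M /\
  forall J : {pred A}, idealr_closed J -> {subset M <= J} -> J =i M.

Definition local_ring (m : {pred A}) : Prop :=
  maximal_ideal m /\ forall M : {pred A}, maximal_ideal M -> M =i m.

Definition prime_ideal (P : {pred A}) : Prop :=
  idealr_closed P /\ prime_idealr_closed P.

(* A strictly increasing chain P 0 < ... < P n of prime ideals. *)
Definition prime_chain (n : nat) (P : nat -> {pred A}) : Prop :=
  (forall i, (i <= n)%N -> prime_ideal (P i)) /\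
  (forall i, (i < n)%N ->
     {subset P i <= P i.+1} /\ exists2 a, a \in P i.+1 & a \notin P i).

Definition krull_dim : \bar int :=
  sup_nat (fun n => exists P, prime_chain n P).

End Ideals.

Section Depth.
Variable A : comNzRingType.

(* u lies in the submodule (s_0, ..., s_(k-1)) M *)
Definition in_mulmod (M : lmodType A) (s : seq A) (u : M) : Prop :=
  exists w : 'I_(size s) -> M, u = \sum_(i < size s) s`_i *: w i.

(* s_i is a nonzerodivisor on M / (s_0, ..., s_(i-1)) M, and M / sM <> 0 *)
Definition regular_seq (M : lmodType A) (s : seq A) : Prop :=
  (forall i, (i < size s)%N -> forall u : M,
     in_mulmod (take i s) (s`_i *: u) -> in_mulmod (take i s) u) /\
  exists u : M, ~ in_mulmod s u.

(* Over a Noetherian ring, for M finitely generated and IM <> M, all maximal   *)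
(* M-regular sequences in I have the same length (Rees): this supremum.        *)
Definition grade (I : {pred A}) (M : lmodType A) : \bar int :=
  sup_nat (fun n => exists s : seq A,
    [/\ size s = n, {in s, forall a, a \in I} & regular_seq M s]).

Definition depth (m : {pred A}) (M : lmodType A) : \bar int :=
  if `[< forall u : M, u = 0 >] then +oo%E else grade m M.

Definition cohen_macaulay_local (m : {pred A}) : Prop :=
  [/\ noetherian A, local_ring m & depth m A^o = krull_dim A].

End Depth.

Section QuotientModule.
Variables (A : comNzRingType) (V : lmodType A) (B : {pred V}).
Hypothesis Bsub : submod_closed B.

Definition submod_of of submod_closed B : {pred V} := B.
HB.instance Definition _ :=
  GRing.isSubmodClosed.Build A V (submod_of Bsub) Bsub.

Definition quotmod : Type := Quotient.quot (submod_of Bsub).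
HB.instance Definition _ := GRing.Zmodule.on quotmod.

Definition quotmod_pi (v : V) : quotmod :=
  \pi_(Quotient.quot (submod_of Bsub))%qT v.
Definition quotmod_repr (q : quotmod) : V :=
  repr (q : Quotient.quot (submod_of Bsub)).
Definition quotmod_scale (a : A) (q : quotmod) : quotmod :=
  quotmod_pi (a *: quotmod_repr q).

Lemma quotmod_piP (u v : V) :
  reflect (quotmod_pi u = quotmod_pi v) (u - v \in B).
Proof.
have -> : (u - v \in B) = (u - v \in submod_of Bsub) by [].
by rewrite Quotient.idealrBE; apply: eqP.
Qed.

Lemma quotmod_piK (q : quotmod) : quotmod_pi (quotmod_repr q) = q.
Proof. exact: reprK. Qed.

Lemma quotmod_piD (u v : V) : quotmod_pi (u + v) = quotmod_pi u + quotmod_pi v.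
Proof. exact: (raddfD \pi_(Quotient.quot (submod_of Bsub))%qT). Qed.

Lemma quotmod_scale_pi (a : A) (v : V) :
  quotmod_scale a (quotmod_pi v) = quotmod_pi (a *: v).
Proof.
apply/quotmod_piP; rewrite -scalerBr.
apply: (@rpredZ _ _ (submod_of Bsub)).
by apply/quotmod_piP; rewrite quotmod_piK.
Qed.

Fact quotmod_scalerA (a b : A) (q : quotmod) :
  quotmod_scale a (quotmod_scale b q) = quotmod_scale (a * b) q.
Proof. by rewrite -[q]quotmod_piK !quotmod_scale_pi scalerA. Qed.

Fact quotmod_scale1r : left_id 1 quotmod_scale.
Proof. by move=> q; rewrite -[q]quotmod_piK quotmod_scale_pi scale1r. Qed.

Fact quotmod_scalerDr : right_distributive quotmod_scale +%R.
Proof.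
move=> a p q; rewrite -[p]quotmod_piK -[q]quotmod_piK.
by rewrite -quotmod_piD !quotmod_scale_pi scalerDr quotmod_piD.
Qed.

Fact quotmod_scalerDl (q : quotmod) :
  {morph quotmod_scale^~ q : a b / a + b}.
Proof.
move=> a b; rewrite -[q]quotmod_piK.
by rewrite !quotmod_scale_pi scalerDl quotmod_piD.
Qed.

HB.instance Definition _ := GRing.Zmodule_isLmodule.Build A quotmod
  quotmod_scalerA quotmod_scale1r quotmod_scalerDr quotmod_scalerDl.

End QuotientModule.

Section Koszul.
Variables (A : comNzRingType) (m : nat) (x : 'I_m -> A).

(* The exterior algebra of A^m: f stands for \sum_S f S e_S, where             *)
(* e_S = e_(j_1) /\ ... /\ e_(j_k) for S = {j_1 < ... < j_k}.                  *)
Definition koszul : Type := {ffun {set 'I_m} -> A^o}.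
HB.instance Definition _ := GRing.Lmodule.on koszul.

(* d e_S = \sum_(j in S) (-1)^#{k in S | k < j} x_j e_(S \ j): the coefficient *)
(* of d f at e_T collects the S = j |: T with j \notin T.                      *)
Definition koszul_sign (j : 'I_m) (T : {set 'I_m}) : A :=
  (-1) ^+ #|[set k in T | (k < j)%N]|.

Definition koszul_d (f : koszul) : koszul :=
  [ffun T : {set 'I_m} =>
     \sum_(j | j \notin T) koszul_sign j T * x j * f (j |: T)].

Definition koszul_degree (i : nat) : {pred koszul} :=
  [pred f : koszul | [forall S : {set 'I_m}, (f S != 0) ==> (#|S| == i)]].

Definition koszul_cycle (i : nat) : {pred koszul} :=
  [pred f | (f \in koszul_degree i) && (koszul_d f == 0)].

Definition koszul_boundary (i : nat) : {pred koszul} :=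
  [pred f | `[< exists2 g, g \in koszul_degree i.+1 & f = koszul_d g >] ].

Lemma koszul_d_is_linear : linear koszul_d.
Proof.
move=> a f g; apply/ffunP => T; rewrite !ffunE scaler_sumr -big_split /=.
apply: eq_bigr => j _; rewrite !ffunE mulrDr; congr (_ + _).
by rewrite /GRing.scale /= mulrCA.
Qed.
HB.instance Definition _ :=
  GRing.isLinear.Build A koszul koszul _ koszul_d koszul_d_is_linear.

Lemma koszul_degreeP (i : nat) (f : koszul) :
  reflect (forall S : {set 'I_m}, #|S| != i -> f S = 0)
          (f \in koszul_degree i).
Proof.
apply: (iffP forallP) => H S; last by apply/implyP; apply: contraNT => /H ->.
by apply: contraNeq => fS; apply: (implyP (H S)).
Qed.

Fact koszul_degree_closed (i : nat) : submod_closed (koszul_degree i).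
Proof.
split=> [|a f g /koszul_degreeP Hf /koszul_degreeP Hg].
  by apply/koszul_degreeP => S _; rewrite ffunE.
by apply/koszul_degreeP => S nS; rewrite !ffunE Hf ?Hg // scaler0 addr0.
Qed.
HB.instance Definition _ (i : nat) := GRing.isSubmodClosed.Build A koszul
  (koszul_degree i) (koszul_degree_closed i).

Fact koszul_cycle_closed (i : nat) : submod_closed (koszul_cycle i).
Proof.
split=> [|a f g]; first by rewrite inE rpred0 linear0 eqxx.
move=> /andP[Hf /eqP df] /andP[Hg /eqP dg].
by rewrite inE rpredD ?rpredZ //= koszul_d_is_linear df dg scaler0 addr0 eqxx.
Qed.
HB.instance Definition _ (i : nat) := GRing.isSubmodClosed.Build A koszul
  (koszul_cycle i) (koszul_cycle_closed i).

Fact koszul_boundary_closed (i : nat) : submod_closed (koszul_boundary i).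
Proof.
split=> [|a f g].
  by apply/asboolP; exists 0; rewrite ?rpred0 ?linear0.
move=> /asboolP[f' Hf ->] /asboolP[g' Hg ->].
by apply/asboolP; exists (a *: f' + g'); rewrite ?rpredD ?rpredZ ?linearP.
Qed.
HB.instance Definition _ (i : nat) := GRing.isSubmodClosed.Build A koszul
  (koszul_boundary i) (koszul_boundary_closed i).

Lemma koszul_signU (j k : 'I_m) (T : {set 'I_m}) : k \notin T ->
  koszul_sign j (k |: T) = (-1) ^+ (k < j)%N * koszul_sign j T.
Proof.
move=> kT; rewrite /koszul_sign -exprD; congr (_ ^+ _).
rewrite (cardsD1 k) !inE eqxx /=; congr (_ + _)%N.
apply: eq_card => l; rewrite !inE; case: eqVneq => //= ->.
by rewrite (negPf kT).
Qed.

Lemma koszul_dd (f : koszul) : koszul_d (koszul_d f) = 0.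
Proof.
apply/ffunP => T; rewrite !ffunE.
pose F j k : A := koszul_sign j T * x j * (koszul_sign k (j |: T) * x k *
  f (k |: (j |: T))).
pose P j k := (j \notin T) && (k \notin T).
have FN j k : P j k && (j < k)%N -> F j k = - F k j.
  case/andP=> /andP[jT kT] ltjk; rewrite /F !koszul_signU // ltjk.
  rewrite ltnNge (ltnW ltjk) /= expr1 expr0 mul1r finset.setUCA.
  move: (koszul_sign j T) (koszul_sign k T) (f _ : A) => a b c; ring.
transitivity (\sum_j \sum_(k | P j k && (j < k)%N) F j k +
              \sum_j \sum_(k | P j k && (k < j)%N) F j k : A).
  rewrite -big_split big_mkcond /=; apply: eq_bigr => j _.
  case: ifPn => [jT|jT]; last first.
    by rewrite !big_pred0 ?addr0 // => k; rewrite /P (negPf jT).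
  rewrite ffunE mulr_sumr (bigID (fun k : 'I_m => (j < k)%N)) /=.
  congr (_ + _); apply: eq_bigl => k; rewrite /P !inE jT negb_or /=.
    by rewrite -val_eqE /=; case: ltngtP; rewrite ?andbF ?andbT.
  by rewrite -val_eqE /=; case: ltngtP; rewrite ?andbF ?andbT.
rewrite [X in _ + X](exchange_big_dep predT) //= -big_split big1 //= => j _.
under [X in _ + X]eq_bigl => k do rewrite /P [(k \notin T) && _]andbC -/(P j k).
by rewrite -big_split big1 //= => k Pjk; rewrite FN // addNr.
Qed.

Lemma koszul_boundary_cycle (i : nat) :
  {subset koszul_boundary i <= koszul_cycle i}.
Proof.
move=> f /asboolP[g /koszul_degreeP Hg ->].
rewrite inE koszul_dd eqxx andbT; apply/koszul_degreeP => T nT.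
rewrite ffunE big1 // => j jT; rewrite Hg ?mulr0 //.
by rewrite cardsU1 jT add1n eqSS.
Qed.

Definition koszul_Z (i : nat) : Type := {f : koszul | f \in koszul_cycle i}.
HB.instance Definition _ (i : nat) := SubChoice.on (koszul_Z i).
HB.instance Definition _ (i : nat) :=
  GRing.SubChoice_isSubLmodule.Build A koszul _ (koszul_Z i)
    (koszul_cycle_closed i).

Definition koszul_B (i : nat) : {pred koszul_Z i} :=
  [pred z | val z \in koszul_boundary i].

Arguments koszul_B i : clear implicits.

Fact koszul_B_closed (i : nat) : submod_closed (koszul_B i).
Proof.
have [B0 BD] := koszul_boundary_closed i.
by split=> [|a u v]; [exact: B0 | exact: BD].
Qed.

Definition koszul_homology (i : nat) : lmodType A :=
  quotmod (@koszul_B_closed i).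

End Koszul.

(* Main.v *)
Require Import Defs.
From mathcomp Require Import all_boot all_order all_algebra.
From mathcomp Require Import boolp classical_sets constructive_ereal.
From mathcomp Require Import ring.
Import Order.TTheory GRing.Theory Num.Theory.
Local Open Scope ring_scope.
Set Implicit Arguments.
Unset Strict Implicit.
Unset Printing Implicit Defensive.

(* Let K be the Koszul complex of x, with cycles Z_i and boundaries B_i. The  *)
(* depth lemma along 0 -> Z_(i+1) -> K_(i+1) -> B_i -> 0 and                  *)
(* 0 -> B_i -> Z_i -> H_i -> 0, going up from Z_0 = A, gives                  *)
(* depth Z_(m-g) >= min(d, c+1). Since H_i = 0 for i > m-g, going down from   *)
(* B_m = 0 gives depth B_(m-g) >= d-g+1, so the second sequence for i = m-g   *)
(* gives depth H_(m-g) >= min(d-g, c+1). Finally c <= depth A/I <= d-g: a     *)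
(* regular sequence in I on A followed by one on A/I yields a chain of primes *)
(* of the same total length.                                                  *)
(*   The depth lemma is proved by testing depth P/Q >= n via the vanishing     *)
(* of H_i(y; P/Q) for i > r - n, where y_1, ..., y_r generate the maximal     *)
(* ideal; it is then a diagram chase. The same vanishing, with x and A in     *)
(* place of y and P/Q, gives H_i = 0 for i > m-g.                             *)
(*   Modules are handled as subquotients P/Q of an ambient module V, where P  *)
(* and Q are Prop-valued predicates on V.                                     *)

(** Where depth is gained and lost decides the result. Going up, B_i inside Z_i and Z_(i+1) inside
    K_(i+1) are kernels, and a kernel has depth at least the minimum of that of the middle term and
    one more than that of the quotient. So the bound c on depth H_i enters as c+1. Going down from
    B_m = 0, each B is a cokernel and costs one unit; exactness above degree m-g allows g such
    steps. [koszul_depth] runs both inductions and views H_(m-g) as the cokernel of B_(m-g) in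
    Z_(m-g): its depth is at least n whenever n <= c+1 and n <= d-g. Part (1) is n = c, allowed
    since c <= d-g; part (2) is n = c+1, and its hypothesis says exactly that n <= d-g.

    The two halves of the depth lemma are [acyclic_sub] and [acyclic_quot]. That Koszul vanishing
    measures depth is [wregular_acyclic], where a homotopy shows that the ideal generated by y kills
    homology, together with [acyclic_wregular], where the vanishing of top homology leaves nothing
    killed by the maximal ideal and prime avoidance ([nzd_exists]) yields a nonzerodivisor. The
    bound c <= d-g rests on [wregular_prime_chain]. *)

Section Submodules.
Variables (A : comNzRingType) (V : lmodType A).
Implicit Types P Q : V -> Prop.

Definition submod P : Prop :=
  P 0 /\ forall a u v, P u -> P v -> P (a *: u + v).

Lemma submodD P u v : submod P -> P u -> P v -> P (u + v).
Proof. by case=> _ h pu pv; rewrite -[u]scale1r; apply: h. Qed.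

Lemma submodZ P a u : submod P -> P u -> P (a *: u).
Proof. by case=> h0 h pu; rewrite -[_ *: _]addr0; apply: h. Qed.

Lemma submodB P u v : submod P -> P u -> P v -> P (u - v).
Proof. by move=> sP pu pv; rewrite addrC -scaleN1r; apply: sP.2. Qed.

Lemma submod_sum P (I : Type) (s : seq I) (p : pred I) (f : I -> V) :
  submod P -> (forall i, p i -> P (f i)) -> P (\sum_(i <- s | p i) f i).
Proof.
by move=> sP Pf; apply: big_ind => //; [case: sP | move=> u v; apply: submodD].
Qed.

Lemma submod_subr P u v : submod P -> P (u - v) -> P v -> P u.
Proof. by move=> sP h pv; rewrite -[u](subrK v); apply: submodD. Qed.

End Submodules.

(** * The Koszul complex with coefficients in a module, and its homotopies *)

Section Koszul.
Variables (A : comNzRingType) (V : lmodType A) (r : nat) (y : 'I_r -> A).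
Implicit Types (f : {set 'I_r} -> V) (P Q : V -> Prop).

(** The differential of the Koszul complex of [y] with coefficients in V, all degrees at once.
    Subquotients P/Q enter only through pointwise membership of values in P and Q. *)
Definition kd f (T : {set 'I_r}) : V :=
  \sum_(j | j \notin T) (koszul_sign A j T * y j) *: f (j |: T).

(** Left exterior multiplication by e_j. *)
Definition kh_gen (j : 'I_r) f (T : {set 'I_r}) : V :=
  if j \in T then koszul_sign A j T *: f (T :\ j) else 0.

Definition kh (c : 'I_r -> A) f (T : {set 'I_r}) : V :=
  \sum_j c j *: kh_gen j f T.

Lemma kdD f g T : kd (fun S => f S + g S) T = kd f T + kd g T.
Proof. by rewrite -big_split; apply: eq_bigr => j _; rewrite scalerDr. Qed.

Lemma kdZ a f T : kd (fun S => a *: f S) T = a *: kd f T.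
Proof.
by rewrite scaler_sumr; apply: eq_bigr => j _; rewrite !scalerA mulrC.
Qed.

Lemma kdB f g T : kd (fun S => f S - g S) T = kd f T - kd g T.
Proof.
rewrite -scaleN1r -kdZ -kdD; apply: eq_bigr => j _.
by rewrite scaleN1r.
Qed.

Lemma kd_sum (I : finType) (F : I -> {set 'I_r} -> V) T :
  kd (fun S => \sum_i F i S) T = \sum_i kd (F i) T.
Proof. by rewrite exchange_big; apply: eq_bigr => j _; rewrite scaler_sumr. Qed.

Lemma kd_mem P f T : submod P -> (forall S, P (f S)) -> P (kd f T).
Proof. by move=> sP Pf; apply: submod_sum => // j _; apply: submodZ. Qed.

Lemma kh_mem P c f T : submod P -> (forall S, P (f S)) -> P (kh c f T).
Proof.
move=> sP Pf; apply: submod_sum => // j _; apply: submodZ => //.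
by rewrite /kh_gen; case: ifP => _; [apply: submodZ | case: sP].
Qed.

Lemma kd_setT f : kd f finset.setT = 0.
Proof. by rewrite /kd big_pred0 // => j; rewrite finset.inE. Qed.

Lemma koszul_sign2 (j : 'I_r) T : koszul_sign A j T * koszul_sign A j T = 1.
Proof. by rewrite -expr2 /koszul_sign sqrr_sign. Qed.

Lemma koszul_sign_id (j : 'I_r) T :
  koszul_sign A j (j |: T) = koszul_sign A j T.
Proof.
rewrite /koszul_sign; congr (_ ^+ _); apply: eq_card => k.
by rewrite !finset.inE; case: eqVneq => // ->; rewrite ltnn !andbF.
Qed.

(** Terms removing some i != j cancel, since exchanging e_i and e_j changes the sign. The term for j
    itself survives, in the first summand if j is outside T and in the second otherwise. *)
Lemma kd_kh_gen j f T : kd (kh_gen j f) T + kh_gen j (kd f) T = y j *: f T.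
Proof.
rewrite {2}/kh_gen; case: ifPn => jT; last first.
  rewrite addr0 /kd (bigD1 j) //= big1 ?addr0 => [|i /andP[iT ij]].
    rewrite /kh_gen setU11 scalerA mulrAC koszul_sign_id koszul_sign2 mul1r.
    by rewrite setU1K.
  by rewrite /kh_gen !finset.inE eq_sym (negPf ij) (negPf jT) scaler0.
rewrite /kd [X in _ + _ *: X](bigD1 j) /=; last by rewrite setD11.
rewrite finset.setD1K // scalerDr scalerA mulrA.
have sD : koszul_sign A j (T :\ j) = koszul_sign A j T.
  by rewrite -koszul_sign_id finset.setD1K.
rewrite sD koszul_sign2 mul1r addrCA.
rewrite -[RHS]addr0; congr (_ + _); rewrite scaler_sumr.
rewrite [X in _ + X](eq_bigl (fun i => i \notin T)); last first.
  move=> i; rewrite !finset.inE negb_and negbK.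
  by case: eqVneq => [->|]; rewrite ?jT ?andbF //= andbT.
rewrite -big_split big1 //= => i iT.
have ij : i != j by apply: contraNneq iT => ->.
rewrite /kh_gen finset.inE jT orbT !scalerA.
have -> : (i |: T) :\ j = i |: T :\ j.
  apply/finset.setP => k; rewrite !finset.inE.
  by case: eqVneq => //= ->; rewrite eq_sym (negPf ij).
rewrite -scalerDl koszul_signU //.
rewrite -{1}[T](finset.setD1K jT) koszul_signU ?setD11 //.
rewrite (_ : _ + _ = 0) ?scale0r //.
move: (koszul_sign A i _) (koszul_sign A j _) => a b.
move: ij; rewrite -val_eqE /=; case: ltngtP => //= _ _; ring.
Qed.

(** Multiplication by an element of the ideal generated by [y] is null-homotopic. *)
Lemma kd_kh c f T :
  kd (kh c f) T + kh c (kd f) T = (\sum_j c j * y j) *: f T.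
Proof.
rewrite /kh kd_sum -big_split scaler_suml /=; apply: eq_bigr => j _.
by rewrite kdZ -scalerDr kd_kh_gen scalerA.
Qed.

Lemma koszul_d_delta (R : {set 'I_r}) T :
  koszul_d y [ffun S => (S == R)%:R] T =
  \sum_(j | j \notin T) (koszul_sign A j T * y j) * (j |: T == R)%:R.
Proof. by rewrite ffunE; apply: eq_bigr => j _; rewrite ffunE. Qed.

Lemma kdE f T :
  kd f T = \sum_S (koszul_d y [ffun R => (R == S)%:R] T : A) *: f S.
Proof.
under eq_bigr => S _ do rewrite koszul_d_delta scaler_suml.
rewrite exchange_big; apply: eq_bigr => j _ /=.
rewrite (bigD1 (j |: T)) //= eqxx mulr1 big1 ?addr0 // => S nS.
by rewrite eq_sym (negPf nS) mulr0 scale0r.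
Qed.

End Koszul.

(** By [kdE] the differential has the same matrix over V as over A, so [koszul_dd] on basis vectors
    suffices. *)
Lemma kd_kd (A : comNzRingType) (V : lmodType A) (r : nat) (y : 'I_r -> A)
  (f : {set 'I_r} -> V) T : kd y (kd y f) T = 0.
Proof.
rewrite kdE; under eq_bigr => S _ do rewrite kdE scaler_sumr.
rewrite exchange_big big1 //= => R _.
under eq_bigr => S _ do rewrite scalerA.
rewrite -scaler_suml.
have := koszul_dd y [ffun S => (S == R)%:R].
move/ffunP/(_ T); rewrite [in RHS]ffunE => E.
suff -> : \sum_S (koszul_d y [ffun S0 => (S0 == S)%:R] T : A) *
  koszul_d y [ffun S0 => (S0 == R)%:R] S = 0 by rewrite scale0r.
rewrite -[RHS]E ffunE; symmetry.
exact: (@kdE A A^o _ y (fun S => koszul_d y [ffun S0 => (S0 == R)%:R] S) T).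
Qed.

(** * Weakly regular sequences on subquotients *)

Section RegularSequences.
Variables (A : comNzRingType) (V : lmodType A).
Implicit Types (P Q : V -> Prop) (s : seq A).

Definition addmul a P Q (u : V) : Prop :=
  exists q p, [/\ Q q, P p & u = q + a *: p].

Definition nzd a P Q : Prop := forall u, P u -> Q (a *: u) -> Q u.

Fixpoint addmuls s P Q : V -> Prop :=
  if s is a :: s' then addmuls s' P (addmul a P Q) else Q.

(** Regularity without the demand that the last quotient be nonzero; for sequences in the maximal
    ideal, [wregular_proper] supplies it. *)
Fixpoint wregular s P Q : Prop :=
  if s is a :: s' then nzd a P Q /\ wregular s' P (addmul a P Q) else True.

Lemma submod_addmul a P Q : submod P -> submod Q -> submod (addmul a P Q).
Proof.
move=> sP sQ; split.
  by exists 0, 0; rewrite scaler0 addr0; split=> //; [case: sQ | case: sP].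
move=> b _ _ [q [p [Qq Pp ->]]] [q' [p' [Qq' Pp' ->]]].
exists (b *: q + q'), (b *: p + p'); split; [exact: sQ.2 | exact: sP.2 |].
by rewrite !scalerDr !scalerA [b * a]mulrC addrACA.
Qed.

Lemma addmulS a P Q u : submod P -> Q u -> addmul a P Q u.
Proof. by move=> [P0 _] Qu; exists u, 0; rewrite scaler0 addr0. Qed.

Lemma addmul_sub a P Q : submod P -> (forall u, Q u -> P u) ->
  forall u, addmul a P Q u -> P u.
Proof.
by move=> sP QP _ [q [p [/QP Pq Pp ->]]]; apply: submodD => //; apply: submodZ.
Qed.

Lemma addmulsP s P Q u : submod P ->
  addmuls s P Q u <-> exists q (w : 'I_(size s) -> V),
    [/\ Q q, forall i, P (w i) & u = q + \sum_(i < size s) s`_i *: w i].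
Proof.
move=> sP; elim: s Q => [|a s IH] Q /=.
  split=> [Qu|[q [w [Qq _ ->]]]]; last by rewrite big_ord0 addr0.
  by exists u, (fun=> 0); split=> // [_|]; [case: sP | rewrite big_ord0 addr0].
rewrite IH; split=> [[_ [w [[q [p [Qq Pp ->]]] Pw ->]]]|[q [w [Qq Pw ->]]]].
  exists q, (fun i => oapp w p (unlift ord0 i)); split=> // [i|].
    by case: (unlift ord0 i).
  rewrite big_ord_recl unlift_none /= addrA; congr (_ + _).
  by apply: eq_bigr => i _; rewrite liftK.
exists (q + a *: w ord0), (fun i => w (lift ord0 i)); split=> //.
  by exists q, (w ord0).
by rewrite big_ord_recl addrA.
Qed.

Lemma wregularP s P Q :
  (forall i, (i < size s)%N -> forall u, P u ->
     addmuls (take i s) P Q (s`_i *: u) -> addmuls (take i s) P Q u) <->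
  wregular s P Q.
Proof.
elim: s Q => [|a s IH] Q; first by split.
split=> [h|[h1 /IH h2]].
  split; first exact: (h 0%N isT).
  by apply/IH => i lti; apply: (h i.+1).
by case=> [_|i lti]; [exact: h1 | exact: h2].
Qed.

Lemma wregular_take n s P Q : wregular s P Q -> wregular (take n s) P Q.
Proof.
by elim: s n Q => [|a s IH] [|n] //= Q [h1 h2]; split=> //; apply: IH.
Qed.

End RegularSequences.

(** * Transfer along isomorphisms of subquotients *)

Section Transfer.
Variables (A : comNzRingType) (V W : lmodType A) (h : V -> W).

(* h induces an isomorphism P/Q -> P'/Q'; it need only be linear on P. *)
Definition quot_iso (P Q : V -> Prop) (P' Q' : W -> Prop) : Prop :=
  [/\ forall a u v, P u -> P v -> h (a *: u + v) = a *: h u + h v,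
      forall u, P u -> P' (h u),
      forall u', P' u' -> exists2 u, P u & h u = u',
      forall u, P u -> Q u <-> Q' (h u) & forall u', Q' u' -> P' u'].

Lemma quot_iso_addmul a P Q P' Q' : submod P -> (forall u, Q u -> P u) ->
  submod P' -> quot_iso P Q P' Q' ->
  quot_iso P (addmul a P Q) P' (addmul a P' Q').
Proof.
move=> sP QP sP' [hlin hP hsurj hQ Q'P']; split=> //; last exact: addmul_sub.
move=> u Pu; split=> [[q [p [Qq Pp ->]]]|[q' [p' [Q'q' P'p' E]]]].
  exists (h q), (h p); split; [exact/hQ/Qq/QP | exact: hP |].
  by rewrite addrC hlin 1?addrC //; apply: QP.
have [p Pp hp] := hsurj _ P'p'.
have Pup : P (u - a *: p) by apply: submodB => //; apply: submodZ.
exists (u - a *: p), p; split; rewrite ?subrK //.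
apply/hQ => //; rewrite addrC -scaleNr hlin // E hp scaleNr addrC addrK //.
Qed.

Lemma quot_iso_wregular s P Q P' Q' : submod P -> submod P' ->
    (forall u, Q u -> P u) -> quot_iso P Q P' Q' ->
  wregular s P Q <-> wregular s P' Q'.
Proof.
move=> sP sP'; elim: s Q Q' => [|a s IH] Q Q' QP iso /=; first by split.
rewrite (IH (addmul a P Q) (addmul a P' Q')); first last.
- exact: quot_iso_addmul.
- exact: addmul_sub.
case: iso => hlin hP hsurj hQ Q'P'.
have h0 : h 0 = 0.
  by rewrite -[X in h X](addrN 0) -scaleN1r addrC hlin ?scaleN1r ?addNr;
    case: sP.
have hZ b u : P u -> h (b *: u) = b *: h u.
  by move=> Pu; rewrite -[b *: u]addr0 hlin ?h0 ?addr0; case: sP.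
split=> -[h1 h2]; split=> // u.
  move=> /hsurj[v Pv <-]; rewrite -hZ // -!hQ //; first exact: h1.
  exact: submodZ.
move=> Pu; rewrite !hQ ?hZ //; last exact: submodZ.
by apply: h1; apply: hP.
Qed.

Lemma quot_iso_addmuls s P Q P' Q' u : submod P -> submod P' ->
    (forall u, Q u -> P u) -> quot_iso P Q P' Q' -> P u ->
  addmuls s P Q u <-> addmuls s P' Q' (h u).
Proof.
move=> sP sP'; elim: s Q Q' => [|a s IH] Q Q' QP iso Pu /=.
  by case: iso => _ _ _ + _; apply.
by apply: IH => //; [apply: addmul_sub | apply: quot_iso_addmul].
Qed.

End Transfer.

(** * Vanishing of Koszul homology and the depth lemma *)

Section KoszulAcyclic.
Variables (A : comNzRingType) (V : lmodType A) (r : nat) (y : 'I_r -> A).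
Implicit Types (f w : {set 'I_r} -> V) (P Q U : V -> Prop).

(** Support in degrees above r - n, without truncated subtraction: n = 0 forces f = 0, and n > r
    imposes nothing. *)
Definition high n f := forall T : {set 'I_r}, (#|T| + n <= r)%N -> f T = 0.

(* The Koszul homology modules H_i(y; P/Q) vanish for i > r - n. *)
Definition acyclic n P Q : Prop :=
  forall f, high n f -> (forall T, P (f T)) -> (forall T, Q (kd y f T)) ->
  exists w, [/\ high n.-1 w, forall T, P (w T) & forall T, Q (f T - kd y w T)].

Lemma cards_ord_leq (T : {set 'I_r}) : (#|T| <= r)%N.
Proof. by have := max_card (mem T); rewrite card_ord. Qed.

Lemma high_kd n f : high n.-1 f -> high n (kd y f).
Proof.
move=> hf T hT; rewrite /kd big1 // => j jT; rewrite hf ?scaler0 //.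
rewrite cardsU1 jT add1n; case: n hT {hf} => [|n] /=; last by rewrite addnS.
by rewrite !addn0 => _; have := cards_ord_leq (j |: T); rewrite cardsU1 jT.
Qed.

Lemma high_kh n c f : high n.+1 f -> high n (kh c f).
Proof.
move=> hf T hT; rewrite /kh big1 // => j _; rewrite /kh_gen.
case: ifP => jT; rewrite ?scaler0 // hf ?scaler0 //.
by move: hT; rewrite (cardsD1 j T) jT addnS.
Qed.

Lemma high_mono n n' f : (n <= n')%N -> high n f -> high n' f.
Proof.
by move=> le hf T hT; apply: hf; apply: leq_trans hT; rewrite leq_add2l.
Qed.

Lemma high0 f T : high 0 f -> f T = 0.
Proof. by apply; rewrite addn0 cards_ord_leq. Qed.

Lemma acyclic0 P Q : submod P -> submod Q -> acyclic 0 P Q.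
Proof.
move=> [P0 _] sQ f hf _ _; exists (fun=> 0); split=> // T.
rewrite high0 // sub0r -scaleN1r; apply: submodZ => //.
by apply: kd_mem => // _; case: sQ.
Qed.

Lemma acyclic_mono n n' P Q : submod P -> submod Q -> (n' <= n)%N ->
  acyclic n P Q -> acyclic n' P Q.
Proof.
move=> sP sQ le ac f hf Pf Qf.
have [w [hw Pw Qw]] := ac f (high_mono le hf) Pf Qf.
(* Cutting [w] off where [high] demands it keeps its boundary in degrees above r - n'; in the other
   degrees [f] and the new boundary both vanish. *)
pose w' (T : {set 'I_r}) := if (#|T| + n'.-1 <= r)%N then 0 else w T.
have hw' : high n'.-1 w' by move=> T hT; rewrite /w' hT.
exists w'; split=> // T.
  by rewrite /w'; case: ifP; case: sP.
case: (leqP (#|T| + n') r) => hT; last first.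
  have -> : kd y w' T = kd y w T; last exact: Qw.
  apply: eq_bigr => j jT; rewrite /w' cardsU1 jT ifN // -ltnNge add1n.
  by apply: leq_trans hT _; rewrite addSn -addnS leq_add2l leqSpred.
by rewrite hf // sub0r (high_kd hw') // oppr0; case: sQ.
Qed.

Lemma acyclic_trivial n P : submod P -> acyclic n P P.
Proof.
move=> sP f hf Pf _; have P0 : P 0 by case: sP.
exists (fun=> 0); split=> // T; apply: submodB => //.
exact: kd_mem.
Qed.

(** Exactness of H_(i+1)(P/U) -> H_i(U/Q) -> H_i(P/Q). A primitive [w] of f in P is a cycle modulo
    U, hence a boundary there, and subtracting that boundary moves [w] into U. *)
Lemma acyclic_sub n P Q U : submod P -> submod Q -> submod U ->
    (forall u, Q u -> U u) -> (forall u, U u -> P u) ->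
  acyclic n.+1 P Q -> acyclic n P U -> acyclic n.+1 U Q.
Proof.
move=> sP sQ sU QU UP acPQ acPU f hf Uf Qf.
have [w [hw Pw Qw]] := acPQ f hf (fun T => UP _ (Uf T)) Qf.
have [|v [hv Pv Uv]] := acPU w hw Pw.
  move=> T; rewrite -[kd y w T](subKr (f T)); apply: submodB => //.
  exact/QU.
exists (fun T => w T - kd y v T); split=> // T.
  by move=> hT; rewrite hw // (high_kd hv) // subrr.
by rewrite kdB kd_kd subr0.
Qed.

(** Exactness of H_i(P/Q) -> H_i(P/U) -> H_(i-1)(U/Q). The boundary of f is a cycle of U/Q;
    subtracting a primitive of it in U turns f into a cycle of P/Q. *)
Lemma acyclic_quot n P Q U : submod P -> submod Q -> submod U ->
    (forall u, Q u -> U u) -> (forall u, U u -> P u) ->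
  acyclic n P Q -> acyclic n.+1 U Q -> acyclic n P U.
Proof.
move=> sP sQ sU QU UP acPQ acUQ f hf Pf Uf.
have [||w [hw Uw Qw]] := acUQ (kd y f) _ Uf.
- by apply: high_kd => /=.
- by move=> T; rewrite kd_kd; case: sQ.
have [||T|v [hv Pv Qv]] := acPQ (fun T => f T - w T).
- by move=> T hT; rewrite hf // hw // subrr.
- by move=> T; apply: submodB => //; apply: UP.
- by rewrite kdB.
exists v; split=> // T; apply: (submod_subr (v := w T)) => //.
by rewrite addrAC; apply/QU/Qv.
Qed.

(** The long exact sequence of multiplication by [a] on M = P/Q places H_i(M/aM) between H_i(M) and
    H_(i-1)(M). *)
Lemma acyclic_addmul n a P Q : submod P -> submod Q -> 
    nzd a P Q -> acyclic n.+1 P Q -> acyclic n P (addmul a P Q).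
Proof.
move=> sP sQ anz ac f hf Pf Qf.
(* [w] is the boundary of [f] divided by [a] modulo Q, chosen 0 in low degrees so that it is again
   [high]. *)
have [w hw] : exists w, forall T, [/\ P (w T), Q (kd y f T - a *: w T)
    & (#|T| + n.+1 <= r)%N -> w T = 0].
  have /choice[w hw] : forall T, exists u, [/\ P u, Q (kd y f T - a *: u)
    & (#|T| + n.+1 <= r)%N -> u = 0].
    move=> T; case: (leqP (#|T| + n.+1) r) => hT.
      exists 0; split=> //; first by case: sP.
      rewrite scaler0 subr0 (@high_kd n.+1) //; by case: sQ.
    by case: (Qf T) => q [p [Qq Pp ->]]; exists p; split; rewrite ?addrK.
  by exists w.
have hh : high n.+1 w by move=> T; case: (hw T).
have Pw T : P (w T) by case: (hw T).
have Qdw T : Q (kd y w T).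
  apply: anz; first exact: kd_mem.
  have -> : a *: kd y w T = -1 *: kd y (fun S => kd y f S - a *: w S) T.
    by rewrite kdB kd_kd kdZ sub0r scaleN1r opprK.
  by apply: submodZ => //; apply: kd_mem => // S; case: (hw S).
have [v [hv Pv Qv]] := ac w hh Pw Qdw.
have [||T|v' [hv' Pv' Qv']] :=
  acyclic_mono sP sQ (leqnSn n) ac (f := fun T => f T - a *: v T).
- by move=> T hT; rewrite hf // hv // scaler0 subrr.
- by move=> T; apply: submodB => //; apply: submodZ.
- rewrite kdB kdZ; apply: (submod_subr (v := a *: (w T - kd y v T))) => //.
    by rewrite scalerBr opprB addrA subrK; case: (hw T).
  exact: submodZ.
exists v'; split=> // T; exists (f T - a *: v T - kd y v' T), (v T).
by split=> //; rewrite addrAC subrK.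
Qed.

(** With [a] the head of the sequence and f a cycle modulo Q, the homotopy [kh c] for [a] makes
    [kh c f] a cycle modulo Q + aP. By induction [kh c f] = [kd y v] + a w modulo Q; taking
    boundaries and cancelling [a] shows that f is the boundary of [w]. *)
Lemma wregular_acyclic s P Q : submod P -> submod Q ->
    (forall a, a \in s -> exists c, a = \sum_j c j * y j) ->
  wregular s P Q -> acyclic (size s) P Q.
Proof.
move=> sP; elim: s Q => [|a s IH] Q sQ sy /=.
  by move=> _; apply: acyclic0.
case=> anz wreg f hf Pf Qf.
have [c ac] := sy a (mem_head a s).
have acs : acyclic (size s) P (addmul a P Q).
  apply: IH wreg; first exact: submod_addmul.
  by move=> b bs; apply: sy; rewrite inE bs orbT.
have [|||v [hv Pv Qv]] := acs (kh c f).
- exact: high_kh.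
- by move=> T; apply: kh_mem.
- move=> T; exists (- kh c (kd y f) T), (f T); split=> //.
    by rewrite -scaleN1r; apply: submodZ => //; apply: kh_mem.
  by rewrite ac -kd_kh addrC addrK.
have [w hw] : exists w, forall T, [/\ P (w T),
    Q (kh c f T - kd y v T - a *: w T) & (#|T| + size s <= r)%N -> w T = 0].
  have /choice[w hw] : forall T, exists u, [/\ P u,
    Q (kh c f T - kd y v T - a *: u) & (#|T| + size s <= r)%N -> u = 0].
    move=> T; case: (leqP (#|T| + size s) r) => hT.
      exists 0; split=> //; first by case: sP.
      rewrite scaler0 subr0 (high_kh c hf) // (high_kd hv) // subrr.
      by case: sQ.
    by case: (Qv T) => q [p [Qq Pp ->]]; exists p; split; rewrite ?addrK.
  by exists w.
exists w; split=> [T|T|T]; try by case: (hw T).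
apply: anz.
  by apply: submodB => //; apply: kd_mem => // S; case: (hw S).
rewrite scalerBr -kdZ ac -kd_kh addrAC; apply: submodD => //; last first.
  exact: kh_mem.
rewrite -kdB -[X in Q X]subr0 -(kd_kd y v T) -kdB.
by apply: kd_mem => // S; rewrite addrAC -ac; case: (hw S).
Qed.

End KoszulAcyclic.

(** * Noetherian modules and maximal elements *)

Section NoetherianModules.
Variable A : comNzRingType.

Definition noethmod (V : lmodType A) : Prop :=
  forall P : V -> Prop, submod P -> exists n (p : 'I_n -> V),
    (forall i, P (p i)) /\ forall u, P u -> exists c, u = \sum_i c i *: p i.

Lemma idealr_closed_submod (J : A -> Prop) :
  @submod A A^o J -> ~ J 1 -> idealr_closed [pred a | `[< J a >]].
Proof.
move=> [J0 J1] nJ1; split; rewrite ?inE //.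
  exact/asboolPn.
by move=> a u v; rewrite !inE; apply: J1.
Qed.

Lemma submod_idealr_closed (J : {pred A}) :
  idealr_closed J -> @submod A A^o (fun a => a \in J).
Proof. by case=> J0 _ J1; split. Qed.

Lemma noethmod_regular : noetherian A -> noethmod A^o.
Proof.
move=> noeA J sJ; case: (pselect (J 1)) => [J1|nJ1].
  exists 1%N, (fun=> 1); split=> // u _; exists (fun=> u).
  by rewrite big_ord1 /GRing.scale /= mulr1.
have [n [p gen]] := noeA _ (idealr_closed_submod sJ nJ1).
exists n, p; split=> [i|u Ju].
  have /gen : exists a : 'I_n -> A, p i = \sum_j a j * p j; last first.
    by rewrite inE.
  exists (fun j => (j == i)%:R); rewrite (bigD1 i) //= eqxx mul1r.
  by rewrite big1 ?addr0 // => j /negPf ->; rewrite mul0r.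
by have /gen[c ->] : u \in [pred a | `[< J a >]]; [rewrite inE | exists c].
Qed.

(** Otherwise dependent choice builds a strictly increasing chain, whose union is finitely generated
    and hence already reached by one of its terms. *)
Lemma noethmod_max (V : lmodType A) (F : (V -> Prop) -> Prop) J0 :
    noethmod V -> (forall J, F J -> submod J) -> F J0 ->
  exists J, [/\ F J, forall u, J0 u -> J u &
    forall J', F J' -> (forall u, J u -> J' u) -> forall u, J' u -> J u].
Proof.
move=> noe sF FJ0; apply: contrapT => nomax.
have step (J : {J | F J /\ forall u, J0 u -> J u}) :
  exists J' : {J | F J /\ forall u, J0 u -> J u},
    (forall u, sval J u -> sval J' u) /\ exists2 u, sval J' u & ~ sval J u.
  case: J => J [FJ J0J] /=; apply: contrapT => noJ; apply: nomax; exists J.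
  split=> // J' FJ' JJ' u J'u; apply: contrapT => nJu; apply: noJ.
  exists (exist _ J' (conj FJ' (fun v J0v => JJ' v (J0J v J0v)))).
  by split; [|exists u].
have [next hnext] := choice step.
pose chain k := iter k next (exist _ J0 (conj FJ0 (fun _ h => h))).
pose J k := sval (chain k).
have JS k u : J k u -> J k.+1 u by apply: (hnext (chain k)).1.
have Jmono k l u : (k <= l)%N -> J k u -> J l u.
  by move=> /subnK <-; elim: (l - k)%N => // n IH /IH; rewrite addSn; apply: JS.
have sJ k : submod (J k) by apply: sF; rewrite /J; case: (chain k) => ? [].
have [|n [p [Up gen]]] := noe (fun u => exists k, J k u).
  split; first by exists 0%N; case: (sJ 0%N).
  move=> a u v [k Ju] [l Jv]; exists (maxn k l).
  by apply: (sJ _).2; [apply: Jmono Ju; apply: leq_maxl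
                      | apply: Jmono Jv; apply: leq_maxr].
have [k hk] := choice Up.
have [u Ju] := (hnext (chain (\max_i k i))).2; apply.
have [c ->] := gen u (ex_intro _ (\max_i k i).+1 Ju).
apply: submod_sum => [|i _]; first exact: sJ.
apply: submodZ; first exact: sJ.
by apply: Jmono (hk i); apply: leq_bigmax.
Qed.

End NoetherianModules.

(** * Maximal annihilators and prime avoidance *)

Section AssociatedPrimes.
Variables (A : comNzRingType) (V : lmodType A) (P Q : V -> Prop).
Hypotheses (noeA : noethmod A^o) (noeV : noethmod V).
Hypotheses (sP : submod P) (sQ : submod Q).

Definition ann_le (u v : V) : Prop := forall a : A, Q (a *: u) -> Q (a *: v).

Definition max_ann (u : V) : Prop :=
  [/\ P u, ~ Q u & forall v, P v -> ~ Q v -> ann_le u v -> ann_le v u].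

Lemma ann_submod u : @submod A A^o (fun a => Q (a *: u)).
Proof.
split=> [|a b c Qb Qc]; first by rewrite scale0r; case: sQ.
by rewrite scalerDl -scalerA; apply: sQ.2.
Qed.

Lemma max_ann_exists u : P u -> ~ Q u -> exists2 v, max_ann v & ann_le u v.
Proof.
move=> Pu nQu.
pose F (J : A^o -> Prop) :=
  exists v, [/\ P v, ~ Q v & J = fun a : A => Q (a *: v)].
have [||_ [[v [Pv nQv ->]] uv vmax]] := @noethmod_max A A^o F
  (fun a : A => Q (a *: u)) noeA.
- by move=> _ [v [_ _ ->]]; apply: ann_submod.
- by exists u.
exists v => //; split=> // w Pw nQw vw.
apply: (vmax (fun a : A => Q (a *: w))) => //.
by exists w.
Qed.

(** If b u is outside Q, its annihilator contains that of u and so equals it by maximality. *)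
Lemma max_ann_prime u a b :
  max_ann u -> Q ((a * b) *: u) -> Q (a *: u) \/ Q (b *: u).
Proof.
move=> [Pu nQu umax] Qab.
case: (pselect (Q (b *: u))) => [|nQb]; [by right | left].
apply: (umax (b *: u)) => //; first exact: submodZ.
  by move=> c Qc; rewrite scalerA mulrC -scalerA; apply: submodZ.
by rewrite scalerA.
Qed.

Fixpoint span (s : seq V) (u : V) : Prop :=
  if s is v :: s' then exists c w, span s' w /\ u = c *: v + w else u = 0.

Lemma span_submod s : submod (span s).
Proof.
elim: s => [|v s [s0 sD]]; split; rewrite /= ?scaler0 //.
- by move=> a u w -> ->; rewrite scaler0 addr0.
- by exists 0, 0; rewrite scale0r addr0.
move=> a _ _ [c [w [sw ->]]] [c' [w' [sw' ->]]].
exists (a * c + c'), (a *: w + w'); split; first exact: sD.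
by rewrite scalerDr scalerDl scalerA addrACA.
Qed.

Lemma mem_span s v : v \in s -> span s v.
Proof.
elim: s => // w s IH; rewrite inE => /predU1P[->|/IH sv].
  by exists 1, 0; rewrite scale1r addr0; split=> //; case: (span_submod s).
by exists 0, v; rewrite scale0r add0r.
Qed.

(** [b] is a product of elements, one killing each v in [s] but not u; it does not kill u because
    the annihilator of u is prime. *)
Lemma prod_ann s u : max_ann u -> (forall v, v \in s -> ~ ann_le v u) ->
  exists b, ~ Q (b *: u) /\ forall w, span s w -> Q (b *: w).
Proof.
move=> umax; elim: s => [|v s IH] /= hs.
  exists 1; rewrite scale1r; split=> [|w ->]; first by case: umax.
  by rewrite scaler0; case: sQ.
have [|b [nQb hb]] := IH; first by move=> w ws; apply: hs; rewrite inE ws orbT.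
have /existsNP[e /not_implyP[Qe nQe]] := hs v (mem_head _ _).
exists (b * e); split=> [/(max_ann_prime umax)[]//|_ [c [w [sw ->]]]].
rewrite scalerDr; apply: submodD => //.
  by rewrite scalerA mulrAC -scalerA; apply: submodZ.
by rewrite mulrC -scalerA; apply: submodZ => //; apply: hb.
Qed.

(** Take a maximal span of such elements. A u whose annihilator contains none of the listed ones
    would lie in that span, yet [prod_ann] gives an element killing the span but not u. *)
Lemma max_ann_finite : exists s : seq V, (forall v, v \in s -> max_ann v) /\
  forall u, max_ann u -> exists2 v, v \in s & ann_le v u.
Proof.
pose F (J : V -> Prop) :=
  exists s, (forall v, v \in s -> max_ann v) /\ J = span s.
have [||_ [[s [smax ->]] _ spanmax]] := @noethmod_max A V F (span [::]) noeV.
- by move=> _ [s [_ ->]]; apply: span_submod.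
- by exists [::].
exists s; split=> // u umax; apply: contrapT => nv.
have [|b [nQb hb]] := prod_ann (s := s) umax.
  by move=> v vs vu; apply: nv; exists v.
apply/nQb/hb; apply: (spanmax (span (u :: s))).
- by exists (u :: s); split=> // v; rewrite inE => /predU1P[->|/smax].
- by move=> w sw; exists 0, w; rewrite scale0r add0r.
exact/mem_span/mem_head.
Qed.

(* The zero divisors on P/Q form the union of finitely many maximal           *)
(* annihilators, which are primes; prime avoidance in mm does the rest.       *)
Lemma nzd_exists (mm : {pred A}) : idealr_closed mm ->
    (forall u, P u -> (forall a, a \in mm -> Q (a *: u)) -> Q u) ->
  exists2 a, a \in mm & nzd a P Q.
Proof.
case=> mm0 _ mmD nosoc.
have avoid (s : seq V) : (forall v, v \in s -> max_ann v) ->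
    exists2 a, a \in mm & forall v, v \in s -> ~ Q (a *: v).
  elim: s => [|v s IH] smax; first by exists 0.
  have [|a am ha] := IH; first by move=> w ws; apply: smax; rewrite inE ws orbT.
  case: (pselect (Q (a *: v))) => [Qav|nQav]; last first.
    by exists a => // w; rewrite inE => /predU1P[->|/ha].
  have vmax := smax v (mem_head _ _); have [Pv nQv _] := vmax.
  have [|b [nQb hb]] := prod_ann (s := s) vmax.
    move=> w ws wv; have [Pw nQw wmax] := smax w (mem_behead (s := v :: s) ws).
    by apply: (ha w ws); apply: wmax Qav.
  have [e em nQe] : exists2 e, e \in mm & ~ Q (e *: v).
    apply: contrapT => ne; apply/nQv/nosoc => // e em.
    by apply: contrapT => nQe; apply: ne; exists e.
  (* [a] avoids the annihilators of [s] but lies in that of [v]. The correction [b * e] lies in all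
     those of [s] and outside that of [v], so the sum avoids them all. *)
  exists (b * e + a); first exact: mmD.
  move=> w; rewrite inE scalerDl => /predU1P[->|ws] Qw.
    have /(max_ann_prime vmax)[] // : Q ((b * e) *: v).
    by rewrite -[_ *: v](addrK (a *: v)); apply: submodB.
  apply: (ha w ws); rewrite -[a *: w](addKr ((b * e) *: w)) addrC.
  apply: submodB => //; rewrite mulrC -scalerA; apply: submodZ => //.
  exact/hb/mem_span.
have [s [smax hs]] := max_ann_finite.
have [a am ha] := avoid s smax.
exists a => // u Pu Qau; apply: contrapT => nQu.
have [v vmax uv] := max_ann_exists Pu nQu.
have [w ws wv] := hs v vmax; have [_ _ wmax] := smax w ws.
by have [Pv nQv _] := vmax; apply: (ha w ws); apply: wmax; last exact: uv.
Qed.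

End AssociatedPrimes.

(** * Local rings: Nakayama, and regular sequences from Koszul vanishing *)

Section LocalRing.
Variables (A : comNzRingType) (mm : {pred A}).
Hypotheses (noeA : noethmod A^o) (locA : local_ring mm).

Lemma local_proper : idealr_closed mm.
Proof. by case: locA => -[]. Qed.

Lemma local_sub (J : A -> Prop) a :
  @submod A A^o J -> ~ J 1 -> J a -> a \in mm.
Proof.
move=> sJ nJ1 Ja.
pose F (K : A^o -> Prop) := submod K /\ ~ K 1.
have [||M [[sM nM1] JM Mmax]] := @noethmod_max A A^o F J noeA.
- by move=> K [].
- by split.
have /(locA.2 _) <- : maximal_ideal [pred a | `[< M a >]].
  split; first exact: idealr_closed_submod.
  move=> K cK MK b; apply/idP/asboolP => [|Mb]; last exact/MK/asboolP.
  apply: (Mmax (fun a => a \in K)) => [|c Mc]; last exact/MK/asboolP.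
  by split; [exact: submod_idealr_closed | case: cK => _ /negP].
exact/asboolP/JM.
Qed.

Lemma local_unit a : a \in mm -> exists b, b * (1 - a) = 1.
Proof.
move=> am; apply: contrapT => nb.
have [mm0 mm1 mmD] := local_proper.
suff h : 1 - a \in mm.
  by case/negP: mm1; rewrite -[1](subrK a) -[1 - a]mul1r mmD.
apply: (@local_sub (fun c => exists b, b * (1 - a) = c)) => //; last first.
  by exists 1; rewrite mul1r.
split; first by exists 0; rewrite mul0r.
move=> c _ _ [b <-] [b' <-]; exists (c * b + b').
by rewrite mulrDl -mulrA.
Qed.

Lemma local_prime : prime_ideal mm.
Proof.
have [mm0 mm1 mmD] := local_proper.
split=> [|u v uv]; first exact: local_proper.
rewrite -implyNb; apply/implyP => nu; apply: contraNT nu => nv.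
apply: (@local_sub (fun c => c * v \in mm)) => //; last first.
  by rewrite mul1r; apply/negP.
split; first by rewrite mul0r.
by move=> c a b av bv; rewrite mulrDl -mulrA; apply: mmD.
Qed.

(** Induction on the number of generators of P modulo Q: the last one satisfies an equation in which
    its coefficient has the form 1 - a c, a unit, so it can be eliminated. *)
Lemma nakayama (V : lmodType A) (P Q : V -> Prop) a : noethmod V ->
    submod P -> submod Q -> a \in mm -> (forall u, P u -> addmul a P Q u) ->
  forall u, P u -> Q u.
Proof.
move=> noeV sP sQ am PQ.
have [n [p [Pp gen]]] := noeV P sP.
have {gen} : forall u, P u -> exists q c, Q q /\ u = q + \sum_i c i *: p i.
  by move=> u /gen[c ->]; exists 0, c; rewrite add0r; split=> //; case: sQ.
elim: n p Pp => [|n IH] p Pp gen u Pu.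
  by have [q [c [Qq ->]]] := gen u Pu; rewrite big_ord0 addr0.
apply: (IH (fun i => p (widen_ord (leqnSn n) i))) => // {u Pu} u Pu.
have [q [w [Qq Pw Ep]]] := PQ _ (Pp ord_max).
have [q' [c [Qq' Ew]]] := gen w Pw.
have [b hb] : exists b, b * (1 - a * c ord_max) = 1.
  apply: local_unit; have [mm0 mm1 mmD] := local_proper.
  by rewrite mulrC -[_ * _]addr0; apply: mmD.
have [q'' [e [Qq'' ->]]] := gen u Pu.
rewrite big_ord_recr /=.
have -> : p ord_max = b *: (q + a *: q' + a *:
    \sum_(i < n) c (widen_ord (leqnSn n) i) *: p (widen_ord (leqnSn n) i)).
  rewrite -[LHS]scale1r -hb -scalerA; congr (_ *: _).
  rewrite scalerBl scale1r {1}Ep Ew big_ord_recr /= !scalerDr !scalerA !addrA.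
  by rewrite addrK.
exists (q'' + (e ord_max * b) *: (q + a *: q')).
exists (fun i => e (widen_ord (leqnSn n) i) +
  e ord_max * b * a * c (widen_ord (leqnSn n) i)); split.
  apply: submodD => //; apply: submodZ => //.
  by apply: submodD => //; apply: submodZ.
under [in RHS]eq_bigr => i _ do rewrite scalerDl -scalerA.
rewrite big_split /= -scaler_sumr scalerA [in LHS]scalerDr.
rewrite -[_ *: (a *: _)]scalerA scalerA -addrA; congr (_ + _); rewrite addrCA.
by rewrite -[(_ * a) *: _]scalerA.
Qed.

Lemma wregular_proper (V : lmodType A) (P Q : V -> Prop) s : noethmod V ->
    submod P -> submod Q -> {in s, forall a, a \in mm} ->
    (exists2 u, P u & ~ Q u) ->
  exists2 u, P u & ~ addmuls s P Q u.
Proof.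
move=> noeV sP; elim: s Q => [|a s IH] Q sQ smm //= [u Pu nQu].
apply: IH; first exact: submod_addmul.
  by move=> b bs; apply: smm; rewrite inE bs orbT.
apply: contrapT => nex; apply: nQu.
apply: (nakayama noeV sP sQ (smm a (mem_head _ _))) Pu => v Pv.
by apply: contrapT => nv; apply: nex; exists v.
Qed.

Lemma acyclic_wregular (V : lmodType A) (P Q : V -> Prop) r (y : 'I_r -> A) n :
    noethmod V -> submod P -> submod Q -> generates y mm -> acyclic y n P Q ->
  exists s, [/\ size s = n, {in s, forall a, a \in mm} & wregular s P Q].
Proof.
move=> noeV sP sQ ymm; elim: n Q sQ => [|n IH] Q sQ ac; first by exists [::].
have nosoc u : P u -> (forall a, a \in mm -> Q (a *: u)) -> Q u.
  move=> Pu mu_.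
  (* Top homology consists of the elements killed by all y_j. Nothing maps into top degree, so its
     vanishing puts [u] in Q. *)
  pose f (T : {set 'I_r}) := if T == finset.setT then u else 0.
  have [||T|w [_ _ /(_ finset.setT)]] := ac f.
  - move=> T; rewrite /f; case: eqP => // ->.
    by rewrite cardsT card_ord addnS ltnNge leq_addr.
  - by move=> T; rewrite /f; case: eqP; case: sP.
  - apply: submod_sum => // j _; rewrite -scalerA; apply: submodZ => //.
    rewrite /f; case: eqP => _; last by rewrite scaler0; case: sQ.
    apply: mu_; apply/ymm; exists (fun i => (i == j)%:R).
    rewrite (bigD1 j) //= eqxx mul1r big1 ?addr0 // => i /negPf ->.
    by rewrite mul0r.
  by rewrite kd_setT subr0 /f eqxx.
have [a am anz] := nzd_exists noeA noeV sP sQ local_proper nosoc.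
have [||s [ss smm sreg]] := IH (addmul a P Q); first exact: submod_addmul.
  exact: acyclic_addmul.
exists (a :: s); split=> //=; first by rewrite ss.
by move=> b; rewrite inE => /predU1P[->|/smm].
Qed.

End LocalRing.

(* Induction on the support, through the ideal of coordinates at one point.   *)
Lemma noethmod_ffun (A : comNzRingType) (X : finType) :
  noethmod A^o -> noethmod {ffun X -> A^o}.
Proof.
move=> noeA.
suff h (s : seq X) (P : {ffun X -> A^o} -> Prop) : submod P ->
    (forall f, P f -> forall t, t \notin s -> f t = 0) ->
    exists n (p : 'I_n -> {ffun X -> A^o}),
    (forall i, P (p i)) /\ forall u, P u -> exists c, u = \sum_i c i *: p i.
  by move=> P sP; apply: (h (enum X)) => // f _ t; rewrite mem_enum.
elim: s P => [|t s IH] P sP Ps.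
  exists 0%N, (fun=> 0); split=> [[]|u Pu] //; exists (fun=> 0).
  by rewrite big_ord0; apply/ffunP => t; rewrite ffunE (Ps _ Pu).
have [|n [a [Ja agen]]] := noeA (fun a => exists2 f, P f & f t = a).
  split; first by exists 0; [case: sP | rewrite ffunE].
  move=> b _ _ [f Pf <-] [f' Pf' <-]; exists (b *: f + f'); first exact: sP.2.
  by rewrite !ffunE.
have {Ja} [p hp] : exists p : 'I_n -> {ffun X -> A^o},
    forall i, P (p i) /\ p i t = a i.
  have /choice[p hp] : forall i, exists f, P f /\ f t = a i.
    by move=> i; have [f] := Ja i; exists f.
  by exists p.
have [||n' [p' [Pp' gen]]] := IH (fun f => P f /\ f t = 0).
- split; first by split; [case: sP | rewrite ffunE].
  move=> b f f' [Pf ft] [Pf' ft']; split; first exact: sP.2.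
  by rewrite !ffunE ft ft' scaler0 addr0.
- move=> f [Pf ft] t' t's; case: (eqVneq t' t) => [->//|nt].
  by apply: Ps => //; rewrite inE negb_or nt.
exists (n + n')%N, (fun i => match split i with inl j => p j | inr j => p' j end).
split=> [i|u Pu].
  by case: (split i) => j; [case: (hp j) | case: (Pp' j)].
have [c uc] := agen (u t) (ex_intro2 _ _ u Pu erefl).
have [|c' uc'] := gen (u - \sum_i c i *: p i).
  split.
    apply: submodB => //; apply: submod_sum => // i _; apply: submodZ => //.
    by case: (hp i).
  rewrite !ffunE sum_ffunE uc; apply/eqP; rewrite subr_eq0; apply/eqP.
  by apply: eq_bigr => i _; rewrite ffunE (hp i).2.
exists (fun i => match split i with inl j => c j | inr j => c' j end).
rewrite -[u](subrK (\sum_i c i *: p i)) uc' addrC big_split_ord /=.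
congr (_ + _); apply: eq_bigr => i _.
  by rewrite (unsplitK (inl _ i)).
by rewrite (unsplitK (inr _ i)).
Qed.

(** * Suprema of sets of naturals *)

Section SupNat.
Variable P : nat -> Prop.
Local Open Scope ereal_scope.

Lemma sup_nat_le e : (forall n, P n -> (n%:Z)%:E <= e) -> sup_nat P <= e.
Proof.
move=> h; rewrite /sup_nat /supremum; case: ifP => _; first exact: leNye.
case: xgetP => [y _ [_ yle]|_]; last exact: leNye.
by apply: yle => _ [n Pn ->]; apply: h.
Qed.

(** A supremum has to be exhibited: the maximum if P is bounded, [+oo] otherwise. *)
Lemma le_sup_nat n : P n -> (n%:Z)%:E <= sup_nat P.
Proof.
move=> Pn; apply: ge_supremum_Nmem; last by exists n.
case: (pselect (exists N, forall k, P k -> (k <= N)%N)) => [[N hN]|unb].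
  have exP : exists k, `[< P k >] by exists n; apply/asboolP.
  have bnd k : `[< P k >] -> (k <= N)%N by move/asboolP/hN.
  case: (ex_maxnP exP bnd) => M /asboolP PM maxM.
  exists (M%:Z)%:E; split=> [_ [k Pk ->]|y]; last by apply; exists M.
  by rewrite lee_fin lez_nat; apply/maxM/asboolP.
exists +oo; split=> [z _|y ub]; first exact: leey.
case: y ub => [z|//|] ub.
  exfalso; apply: unb; exists `|z|%N => k Pk.
  have := ub _ (ex_intro2 _ _ k Pk erefl); rewrite lee_fin => kz.
  by rewrite -lez_nat gez0_abs // (le_trans _ kz).
by have := ub _ (ex_intro2 _ _ n Pn erefl); rewrite leeNy_eq.
Qed.

Lemma sup_nat_witness k : (k%:Z)%:E <= sup_nat P -> exists2 n, P n & (k <= n)%N.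
Proof.
move=> le; apply: contrapT => nex.
have : sup_nat P <= (k%:Z - 1)%:E.
  apply: sup_nat_le => n Pn; rewrite lee_fin lerBrDr addrC -intS lez_nat ltnNge.
  by apply/negP => kn; apply: nex; exists n.
by move/(le_trans le); rewrite lee_fin lerBrDl gerDr.
Qed.

End SupNat.

(** * Grade and depth through weakly regular sequences *)

Section Depth.
Variables (A : comNzRingType) (I : {pred A}).

(* If P = Q this holds for every n, matching depth 0 = +oo. *)
Definition depth_ge (V : lmodType A) n (P Q : V -> Prop) : Prop :=
  exists s, [/\ size s = n, {in s, forall a, a \in I} & wregular s P Q].

Lemma in_mulmodE (M : lmodType A) s (u : M) :
  in_mulmod s u <-> addmuls s (fun=> True) (fun v => v = 0) u.
Proof.
rewrite addmulsP //; split=> [[w ->]|[_ [w [-> _ ->]]]].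
  by exists 0, w; rewrite add0r.
by exists w; rewrite add0r.
Qed.

Lemma regular_seqE (M : lmodType A) s :
  regular_seq M s <-> wregular s (fun=> True) (fun v : M => v = 0) /\
    exists u : M, ~ addmuls s (fun=> True) (fun v => v = 0) u.
Proof.
rewrite -wregularP; split=> -[h [u nu]]; split.
- by move=> i lti v _ /in_mulmodE/(h i lti)/in_mulmodE.
- by exists u => /in_mulmodE.
- by move=> i lti v /in_mulmodE/(h i lti v Logic.I)/in_mulmodE.
- by exists u => /in_mulmodE.
Qed.

Lemma grade_ge_regular (M : lmodType A) k :
  ((k%:Z)%:E <= grade I M)%E ->
  depth_ge k (fun=> True) (fun v : M => v = 0).
Proof.
move=> /sup_nat_witness[n [s [ss sI /regular_seqE[sreg _]]] kn].
exists (take k s); split; first by rewrite size_takel // ss.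
  by move=> a /mem_take /sI.
exact: wregular_take.
Qed.

End Depth.

(** * Chains of primes from regular sequences *)

Section PrimeChains.
Variable A : comNzRingType.
Hypothesis noeA : noethmod A^o.

(* P' is an ideal maximal among those containing J and avoiding every s * a^k *)
(* with s outside P; J is one of them because a is a nonzerodivisor on A/J.   *)
Lemma prime_below (J : A -> Prop) (P : {pred A}) a :
    @submod A A^o J -> prime_ideal P -> (forall b, J b -> b \in P) ->
    @nzd A A^o a (fun=> True) J ->
  exists P' : {pred A}, [/\ prime_ideal P', forall b, J b -> b \in P',
    {subset P' <= P} & a \notin P'].
Proof.
move=> sJ [[P0 P1 PD] Pprime] JP anz.
pose F (K : A^o -> Prop) :=
  @submod A A^o K /\ forall s k, s \notin P -> ~ K (s * a ^+ k).
have [||M [[sM nM] JM Mmax]] := @noethmod_max A A^o F J noeA.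
- by move=> K [].
- split=> // s k /negP sP Jsa; apply/sP/JP; elim: k Jsa => [|k IH].
    by rewrite mulr1.
  by rewrite exprS mulrCA => /(anz _ Logic.I)/IH.
have Mlarge u : ~ M u -> exists s k b, [/\ s \notin P & M (s * a ^+ k - b * u)].
  move=> nMu; apply: contrapT => nex; apply: nMu.
  apply: (Mmax (@addmul A A^o u (fun=> True) M)).
  - split; first exact: submod_addmul.
    move=> s k sP [q [b [Mq _ E]]]; apply: nex; exists s, k, b; split=> //.
    by rewrite E /GRing.scale /= mulrC addrK.
  - by move=> b Mb; apply: addmulS.
  by exists 0, 1; split; [case: sM | | rewrite add0r /GRing.scale /= mulr1].
have MP b : M b -> b \in P.
  move=> Mb; apply: contrapT => /negP bP.
  by apply: (nM b 0%N bP); rewrite mulr1.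
pose P' : {pred A} := [pred b | `[< M b >]].
exists P'; split.
- split; first apply: idealr_closed_submod => // /MP; first exact/negP.
  move=> u v /asboolP Muv.
  case: (pselect (M u)) => [Mu|nMu]; first by apply/orP; left; apply/asboolP.
  apply/orP; right; apply/asboolP; apply: contrapT => nMv.
  have [s [k [b [sP Ms]]]] := Mlarge u nMu.
  have [s' [k' [b' [sP' Ms']]]] := Mlarge v nMv.
  apply: (nM (s * s') (k + k')%N).
    by apply: contraNN sP => /Pprime/orP[//|h]; rewrite h in sP'.
  have -> : s * s' * a ^+ (k + k') = (s' * a ^+ k') *: (s * a ^+ k - b * u : A^o)
    + ((b * u) *: (s' * a ^+ k' - b' * v : A^o) + (b * b') *: (u * v : A^o)).
    by rewrite exprD /GRing.scale /=; ring.
  apply: (submodD sM); first exact: submodZ.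
  by apply: (submodD sM); exact: submodZ.
- by move=> b /JM Mb; apply/asboolP.
- by move=> b /asboolP/MP.
- by apply/asboolPn => Ma; apply: (nM 1 1%N P1); rewrite mul1r.
Qed.

(** The chain grows at its lower end. The tail, regular modulo J + aA, is handled by induction and
    leaves a lowest prime containing J and [a]; [prime_below] then puts under it a prime that
    contains J but not [a]. *)
Lemma wregular_prime_chain s (J : A -> Prop) N F :
    @submod A A^o J -> @wregular A A^o s (fun=> True) J ->
    prime_chain N F -> {in s, forall a, a \in F 0%N} ->
    (forall b, J b -> b \in F 0%N) ->
  exists F', prime_chain (N + size s) F' /\ forall b, J b -> b \in F' 0%N.
Proof.
elim: s J => [|a s IH] J sJ /=; first by rewrite addn0; exists F.
move=> [anz sreg] chF sF JF.
have [|b bs|b|F' [[F'p F'c] JF']] := IH _ _ sreg chF.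
- exact: submod_addmul.
- by apply: sF; rewrite inE bs orbT.
- move=> [q [c [Jq _ ->]]]; have [[F0 _ FD] _] := chF.1 0%N isT.
  rewrite addrC /GRing.scale /= mulrC.
  by apply: FD; [apply: sF (mem_head _ _) | apply: JF].
have [b Jb|P' [P'p JP' P'F nP'a]] := prime_below sJ (F'p 0%N isT) _ anz.
  by apply: JF'; apply: addmulS.
exists (fun i => if i is i'.+1 then F' i' else P'); split=> //.
rewrite addnS; split=> [[|i] //|[|i] lti]; [exact: F'p | | exact: F'c].
split=> //; exists a => //; apply: JF'.
by exists 0, 1; split; [case: sJ | | rewrite add0r /GRing.scale /= mulr1].
Qed.

End PrimeChains.

(** * Cycles, boundaries and homology as subquotients of one Noetherian module *)

Section KoszulModules.
Variables (A : comNzRingType) (m : nat) (x : 'I_m -> A).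
Local Notation K := (koszul A m).

Definition Kdeg i (f : K) : Prop := f \in koszul_degree i.
Definition Kcyc i (f : K) : Prop := f \in koszul_cycle x i.
Definition Kbnd i (f : K) : Prop := f \in koszul_boundary x i.

Lemma submod_of_closed (V : lmodType A) (S : {pred V}) :
  submod_closed S -> submod (fun u => u \in S).
Proof. by case=> S0 SD; split. Qed.

Lemma Kdeg_submod i : submod (Kdeg i).
Proof. exact/submod_of_closed/koszul_degree_closed. Qed.

Lemma Kcyc_submod i : submod (Kcyc i).
Proof. exact/submod_of_closed/koszul_cycle_closed. Qed.

Lemma Kbnd_submod i : submod (Kbnd i).
Proof. exact/submod_of_closed/koszul_boundary_closed. Qed.

Lemma Kcyc_Kdeg i f : Kcyc i f -> Kdeg i f.
Proof. by rewrite /Kcyc inE => /andP[]. Qed.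

Lemma Kbnd_Kcyc i f : Kbnd i f -> Kcyc i f.
Proof. exact: koszul_boundary_cycle. Qed.

Lemma zero_submod (V : lmodType A) : submod (fun u : V => u = 0).
Proof. by split=> // a u v -> ->; rewrite scaler0 addr0. Qed.

Lemma quot_iso_boundary i :
  quot_iso (koszul_d x) (Kdeg i.+1) (Kcyc i.+1) (Kbnd i) (fun f => f = 0).
Proof.
split.
- by move=> a f g _ _; rewrite linearP.
- by move=> f df; apply/asboolP; exists f.
- by move=> f /asboolP[g dg ->]; exists g.
- move=> f df; rewrite /Kcyc inE; split=> [/andP[_ /eqP]//|->].
  by rewrite eqxx andbT.
by move=> _ ->; case: (Kbnd_submod i).
Qed.

(** Homology is built on the subtype of cycles; [insubd 0] sends non-cycles to the default 0, so
    linearity is available only on cycles. *)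
Lemma quot_iso_homology i :
  quot_iso (fun f : K => quotmod_pi (koszul_B_closed x i) (insubd 0 f))
    (Kcyc i) (Kbnd i) (fun=> True) (fun u : koszul_homology x i => u = 0).
Proof.
have insK f : Kcyc i f -> val (insubd (0 : koszul_Z x i) f) = f.
  exact: insubdK.
have insub_lin a f g : Kcyc i f -> Kcyc i g ->
    insubd (0 : koszul_Z x i) (a *: f + g) = a *: insubd 0 f + insubd 0 g.
  move=> cf cg; apply: val_inj; rewrite insK; last exact: (Kcyc_submod i).2.
  by rewrite linearP; congr (_ *: _ + _); rewrite -[LHS]insK.
split=> //.
- move=> a f g cf cg; rewrite insub_lin // quotmod_piD; congr (_ + _).
  by rewrite -quotmod_scale_pi.
- move=> u _; exists (val (quotmod_repr u)); first exact: valP.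
  by rewrite valKd quotmod_piK.
move=> f cf; have pi0 : quotmod_pi (koszul_B_closed x i) 0 = 0.
  apply: (addrI (quotmod_pi (koszul_B_closed x i) 0)).
  by rewrite -quotmod_piD !addr0.
have E : (insubd (0 : koszul_Z x i) f - 0 \in @koszul_B A m x i) =
    (f \in koszul_boundary x i).
  by rewrite subr0 -[in RHS](insK f cf).
rewrite -[X in _ = X]pi0 /Kbnd -E.
split=> h; first exact: (elimT (quotmod_piP _ _ _) h).
exact: (introT (quotmod_piP _ _ _) h).
Qed.

Definition Kconst (a : A^o) : K := [ffun S => if S == finset.set0 then a else 0].

Lemma Kdeg0E f : Kdeg 0 f -> f = Kconst (f finset.set0).
Proof.
move/koszul_degreeP => df; apply/ffunP => S; rewrite ffunE.
by case: eqVneq => [->//|nS]; rewrite df // cards_eq0.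
Qed.

Lemma Kconst_deg a : Kdeg 0 (Kconst a).
Proof. by apply/koszul_degreeP => S; rewrite cards_eq0 ffunE => /negPf ->. Qed.

Lemma Kcyc0E f : Kcyc 0 f <-> Kdeg 0 f.
Proof.
split=> [|df]; first exact: Kcyc_Kdeg.
rewrite /Kcyc inE; apply/andP; split=> //; apply/eqP/ffunP => T; rewrite !ffunE.
by rewrite big1 // => j jT; rewrite (koszul_degreeP _ _ df) ?mulr0 // cardsU1 jT.
Qed.

(** This is A/I = H_0: at the empty set, the boundary of a degree 1 element is a combination of the
    x_j. *)
Lemma quot_iso_Kconst (I : {pred A}) : generates x I ->
  quot_iso Kconst (fun=> True) (fun a => a \in I) (Kcyc 0) (Kbnd 0).
Proof.
move=> gen; split.
- move=> a u v _ _; apply/ffunP => S; rewrite !ffunE.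
  by case: eqP => // _; rewrite scaler0 addr0.
- by move=> a _; apply/Kcyc0E/Kconst_deg.
- by move=> f /Kcyc0E/Kdeg0E ->; exists (f finset.set0).
- move=> a _.
  have d0 (g : K) :
      koszul_d x g finset.set0 = \sum_j g (finset.set1 j) * x j.
    rewrite ffunE; apply: eq_big => [j|j _]; first by rewrite finset.inE.
    rewrite finset.setU0 mulrC /koszul_sign (_ : #|_| = 0%N) ?mul1r //.
    apply/eqP; rewrite cards_eq0; apply/eqP/finset.setP => k.
    by rewrite !finset.inE.
  split=> [/gen[c ->]|/asboolP[g _ E]].
    pose g : K := [ffun S => \sum_j if S == finset.set1 j then c j else 0].
    have dg : g \in koszul_degree 1.
      apply/koszul_degreeP => S nS; rewrite ffunE big1 // => j _.
      by case: (S =P finset.set1 j) nS => [->|//]; rewrite cards1.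
    apply/asboolP; exists g => //.
    rewrite [RHS]Kdeg0E; last first.
      by apply/Kcyc_Kdeg/koszul_boundary_cycle/asboolP; exists g.
    congr Kconst; rewrite d0; apply: eq_bigr => j _; congr (_ * _).
    rewrite ffunE (bigD1 j) //= eqxx big1 ?addr0 // => i ij.
    by rewrite (inj_eq finset.set1_inj) eq_sym (negPf ij).
  apply/gen; exists (fun j => g (finset.set1 j)); rewrite -d0 -E.
  by rewrite ffunE eqxx.
exact: Kbnd_Kcyc.
Qed.

Lemma wregular_ext (V : lmodType A) s (P Q Q' : V -> Prop) :
  (forall u, Q u <-> Q' u) -> wregular s P Q -> wregular s P Q'.
Proof. by move=> QQ'; rewrite (funext (fun u => propext (QQ' u))). Qed.

(** K_i is free, so regularity is checked coordinate by coordinate. *)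
Lemma wregular_Kdeg s (Q : A^o -> Prop) i : submod Q ->
    wregular s (fun=> True) Q ->
  wregular s (Kdeg i) (fun f => Kdeg i f /\ forall S, Q (f S)).
Proof.
elim: s Q => [|a s IH] Q sQ //= [anz sreg]; split.
  move=> f df [_ Qf]; split=> // S; apply: anz => //.
  by have := Qf S; rewrite ffunE.
apply: wregular_ext (IH _ _ sreg); last exact: submod_addmul.
move=> f; split=> [[df]|[q [p [[dq Qq] dp ->]]]]; last first.
  split.
    by apply: (submodD (Kdeg_submod i)) => //; apply: submodZ (Kdeg_submod i) _.
  by move=> S; exists (q S), (p S); rewrite !ffunE.
move=> hf.
(* Choosing 0 wherever [f] vanishes keeps the family [p] homogeneous of degree i. *)
have /choice[p hp] : forall S, exists p : A^o,
    Q (f S - a *: p) /\ (f S = 0 -> p = 0).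
  move=> S; case: (eqVneq (f S) 0) => [->|nf].
    by exists 0; rewrite scaler0 subr0; split=> //; case: sQ.
  have [q [p [Qq _ E]]] := hf S; exists p; rewrite E addrK; split=> // fS0.
  by rewrite E fS0 eqxx in nf.
have dp : Kdeg i [ffun S => p S].
  apply/koszul_degreeP => S nS; rewrite ffunE (hp S).2 //.
  exact: (koszul_degreeP _ _ df).
exists (f - a *: ([ffun S => p S] : K)), [ffun S => p S].
rewrite subrK; split=> //; split.
  by apply: (submodB (Kdeg_submod i)) => //; apply: submodZ (Kdeg_submod i) _.
by move=> S; rewrite !ffunE; case: (hp S).
Qed.

Lemma acyclic_boundary n i f :
  @acyclic A A^o m x n (fun=> True) (fun u => u = 0) ->
  (m < i + n)%N -> Kcyc i f -> Kbnd i f.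
Proof.
move=> ac lt; rewrite /Kcyc inE => /andP[/koszul_degreeP df /eqP d0].
have [||T|w [_ _ hw]] := ac (fun S => f S).
- move=> T hT; apply: df; apply: contraTN hT => /eqP ->; by rewrite -ltnNge.
- by [].
- by have /ffunP/(_ T) := d0; rewrite !ffunE.
(* Only the component of [w] in degree i+1 contributes to the boundary in degree i. *)
apply/asboolP; exists [ffun S : {set 'I_m} => if #|S| == i.+1 then w S else 0].
  by apply/koszul_degreeP => S /negPf nS; rewrite ffunE nS.
apply/ffunP => T; rewrite ffunE; case: (eqVneq #|T| i) => hT; last first.
  rewrite df // big1 // => j jT; rewrite ffunE cardsU1 jT add1n eqSS (negPf hT).
  by rewrite mulr0.
rewrite (subr0_eq (hw T)); apply: eq_bigr => j jT.
by rewrite ffunE cardsU1 jT add1n hT eqxx.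
Qed.

End KoszulModules.

Lemma wregular_trivial (A : comNzRingType) (V : lmodType A) s (P Q : V -> Prop) :
  submod P -> (forall u, P u -> Q u) -> wregular s P Q.
Proof.
move=> sP; elim: s Q => [|a s IH] Q //= PQ; split=> [u /PQ //|].
by apply: IH => u /PQ; apply: addmulS.
Qed.

Lemma quot_iso_depth_ge (A : comNzRingType) (I : {pred A}) (V W : lmodType A)
    (h : V -> W) n P Q P' Q' : submod P -> submod P' ->
    (forall u, Q u -> P u) -> quot_iso h P Q P' Q' ->
  depth_ge I n P Q <-> depth_ge I n P' Q'.
Proof.
move=> sP sP' QP iso.
by split=> -[s [ss sI sreg]]; exists s; split=> //;
  apply/(quot_iso_wregular s sP sP' QP iso).
Qed.

Lemma true_submod (A : comNzRingType) (V : lmodType A) :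
  submod (fun _ : V => True).
Proof. by split. Qed.

(** * Depth over a Noetherian local ring, and the two inductions *)

Section LocalDepth.
Variables (A : comNzRingType) (mm : {pred A}).
Hypotheses (noeA : noetherian A) (locA : local_ring mm).

Let noeAo : noethmod A^o := noethmod_regular noeA.

Lemma depth_ge_acyclic : exists r (y : 'I_r -> A),
  forall (V : lmodType A) n (P Q : V -> Prop), noethmod V ->
    submod P -> submod Q -> depth_ge mm n P Q <-> acyclic y n P Q.
Proof.
have [r [y ymm]] := noeA (local_proper locA); exists r, y.
move=> V n P Q noeV sP sQ; split=> [[s [<- smm sreg]]|]; last first.
  exact: acyclic_wregular.
by apply: wregular_acyclic => // a /smm /ymm.
Qed.

Lemma depth_ge_depth (M : lmodType A) n : ((n%:Z)%:E <= depth mm M)%E ->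
  depth_ge mm n (fun=> True) (fun u : M => u = 0).
Proof.
rewrite /depth; case: asboolP => [M0 _|_]; last exact: grade_ge_regular.
(* The zero module has depth [+oo], and any sequence is weakly regular on it. *)
exists (nseq n 0); rewrite size_nseq; split=> //.
  by move=> a /nseqP[-> _]; case: (local_proper locA).
by apply: wregular_trivial => // u _; apply: M0.
Qed.

Lemma depth_ge0 (M : lmodType A) : (0%:E <= depth mm M)%E.
Proof.
rewrite /depth; case: asboolP => [_|/existsNP[u nu]]; first exact: leey.
apply: (@le_sup_nat _ 0%N); exists [::]; split=> //.
by apply/regular_seqE; split=> //; exists u.
Qed.

(** Nakayama upgrades weak regularity to regularity when M is nonzero. *)
Lemma depth_depth_ge (V M : lmodType A) (h : V -> M) n (P Q : V -> Prop) :
    noethmod V -> submod P -> submod Q -> (forall u, Q u -> P u) ->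
    quot_iso h P Q (fun=> True) (fun u => u = 0) ->
  depth_ge mm n P Q -> ((n%:Z)%:E <= depth mm M)%E.
Proof.
move=> noeV sP sQ QP iso [s [ss smm sreg]].
rewrite /depth; case: asboolP => [_|/existsNP[u nu]]; first exact: leey.
have [_ _ hsurj hQ _] := iso.
apply: le_sup_nat; exists s; split=> //; apply/regular_seqE; split.
  by apply/(quot_iso_wregular s sP (true_submod M) QP iso).
have [|v Pv nv] := wregular_proper noeAo locA noeV sP sQ smm.
  by have [v Pv hv] := hsurj u Logic.I; exists v => // /(hQ _ Pv); rewrite hv.
exists (h v) => hv; apply: nv.
exact/(quot_iso_addmuls s sP (true_submod M) QP iso Pv).
Qed.

Section KoszulDepth.
Variables (m : nat) (x : 'I_m -> A) (I : {pred A}) (d g : nat).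
Hypotheses (hx : generates x I) (gd : (g <= d)%N) (gm : (g <= m)%N).
Hypotheses (depthA : depth_ge mm d (fun=> True) (fun a : A^o => a = 0)).
Hypotheses (gradeI : depth_ge I g (fun=> True) (fun a : A^o => a = 0)).

Lemma koszul_exact i f : (m < i + g)%N -> Kcyc x i f -> Kbnd x i f.
Proof.
have [s [<- sI sreg]] := gradeI; apply: acyclic_boundary.
by apply: wregular_acyclic => //; [exact: zero_submod | move=> a /sI /hx].
Qed.

Lemma depth_ge_Kdeg i : depth_ge mm d (@Kdeg A m i) (fun f => f = 0).
Proof.
have [s [ss smm sreg]] := depthA; exists s; split=> //.
apply: (wregular_ext _ (wregular_Kdeg m i (@zero_submod A A^o) sreg)) => f.
split=> [[_ f0]|->]; first by apply/ffunP => S; rewrite f0 ffunE.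
by split=> [|S]; [case: (@Kdeg_submod A m i) | rewrite ffunE].
Qed.

Lemma koszul_depth k n :
    (forall i, (i < m - g)%N -> depth_ge mm k (Kcyc x i) (Kbnd x i)) ->
    (n <= k.+1)%N -> (n + g <= d)%N ->
  depth_ge mm n (Kcyc x (m - g)) (Kbnd x (m - g)).
Proof.
move=> hH nk ngd.
have [r [y E]] := depth_ge_acyclic.
have noeK : noethmod (koszul A m) := noethmod_ffun noeAo.
have s0 := @zero_submod A (koszul A m).
have sK := @Kdeg_submod A m; have sZ := Kcyc_submod x.
have sB := Kbnd_submod x.
have Z0 i (f : koszul A m) : f = 0 -> Kcyc x i f by move=> ->; case: (sZ i).
have B0 i (f : koszul A m) : f = 0 -> Kbnd x i f by move=> ->; case: (sB i).
have acK i l : (l <= d)%N -> acyclic y l (@Kdeg A m i) (fun f => f = 0).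
  move=> ld; apply: acyclic_mono ld _ => //.
  by apply/E => //; apply: depth_ge_Kdeg.
have acKZ i l : acyclic y l (@Kdeg A m i.+1) (Kcyc x i.+1) <->
    acyclic y l (Kbnd x i) (fun f => f = 0).
  rewrite -!E //.
  apply: (quot_iso_depth_ge _ _ _ _ _ (quot_iso_boundary x i)) => //.
  exact: Kcyc_Kdeg.
(* The upward induction. With n = l+1, [acyclic_sub] asks of H_i only depth l, which is at most
   k. *)
have acZ i : (i <= m - g)%N -> acyclic y n (Kcyc x i) (fun f => f = 0).
  case: n nk ngd => [|l] nk ngd; first by move=> _; apply: acyclic0.
  elim: i => [_|i IH ltim].
    have -> : Kcyc x 0 = @Kdeg A m 0 by apply/funext => f; apply/propext/Kcyc0E.
    by apply: acK; apply: leq_trans ngd; apply: leq_addr.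
  apply: (acyclic_sub (sK _) s0 (sZ _) (Z0 _) (@Kcyc_Kdeg _ _ x _)).
    by apply: acK; apply: leq_trans ngd; apply: leq_addr.
  apply/acKZ; apply: (@acyclic_mono _ _ _ _ l.+1) => //.
  apply: (acyclic_sub (sZ i) s0 (sB i) (B0 i) (@Kbnd_Kcyc _ _ x i)).
    exact: IH (ltnW ltim).
  by apply: (@acyclic_mono _ _ _ _ k) => //; apply/E => //; apply: hH.
(* The downward induction, in the codegree t: from depth d-t+1 for B_(m-t) to d-t for B_(m-t-1), as
   long as H_(m-t) = 0, that is t < g. *)
have acB t : (t <= g)%N ->
    acyclic y (d - t).+1 (Kbnd x (m - t)) (fun f => f = 0).
  elim: t => [_|t IH tg].
    have -> : Kbnd x (m - 0) = fun f => f = 0.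
      apply/funext => f; apply/propext; split=> [|/B0 //]; rewrite subn0.
      move=> /asboolP[h /koszul_degreeP dh ->].
      suff -> : h = 0 by rewrite linear0.
      apply/ffunP => S; rewrite ffunE dh // neq_ltn.
      by have := max_card (mem S); rewrite card_ord ltnS => ->.
    exact: acyclic_trivial.
  have td : (t < d)%N := leq_trans tg gd.
  have tm : (t < m)%N := leq_trans tg gm.
  have Em : (m - t = (m - t.+1).+1)%N by rewrite subnSK.
  rewrite subnSK //; apply/acKZ; rewrite -Em.
  apply: (acyclic_quot (sK _) s0 (sZ _) (Z0 _) (@Kcyc_Kdeg _ _ x _)).
    exact/acK/leq_subr.
  have -> : Kcyc x (m - t) = Kbnd x (m - t); last exact: IH (ltnW tg).
  apply/funext => f; apply/propext; split; last exact: Kbnd_Kcyc.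
  apply: koszul_exact; rewrite -[X in (X < _)%N](subnK (ltnW tm)).
  by rewrite ltn_add2l.
apply/E => //.
apply: (acyclic_quot (sZ _) s0 (sB _) (B0 _) (@Kbnd_Kcyc _ _ x _)).
  exact: acZ.
apply: acyclic_mono (acB g _) => //.
by rewrite ltnS leq_subRL // addnC.
Qed.

End KoszulDepth.

End LocalDepth.

Theorem theorem1p8 (A : comNzRingType) (mm : {pred A}) (d : nat)
    (I : {pred A}) (m g : nat) (x : 'I_m -> A) (c : \bar int)
    (hCM : cohen_macaulay_local mm) (hd : krull_dim A = (d%:Z)%:E)
    (hI : idealr_closed I) (hm : m = mu I) (hg : grade I A^o = (g%:Z)%:E)
    (hgm : (g < m)%N) (hx : generates x I)
    (hc : c = \big[Order.min/+oo%E]_(i < m - g)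
                depth mm (koszul_homology x i)) :
  (c <= depth mm (koszul_homology x (m - g)))%E /\
  ((c < (d%:Z - g%:Z)%:E)%E ->
   (c + 1 <= depth mm (koszul_homology x (m - g)))%E).
Proof.
have [noeA locA hdepth] := hCM.
have noeAo := noethmod_regular noeA.
have depthA : depth_ge mm d (fun=> True) (fun a : A^o => a = 0).
  by apply: depth_ge_depth => //; rewrite hdepth hd.
have gradeI : depth_ge I g (fun=> True) (fun a : A^o => a = 0).
  by apply: grade_ge_regular; rewrite hg.
have mg0 : (0 < m - g)%N by rewrite subn_gt0.
have iso i := quot_iso_homology x i.
have le_d e : depth_ge mm e (Kcyc x 0) (Kbnd x 0) -> (e + g <= d)%N.
  move/(quot_iso_depth_ge mm e (@true_submod A A^o) (Kcyc_submod x 0)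
    (fun _ _ => Logic.I) (quot_iso_Kconst hx)).
  move=> [s [<- smm sreg]].
  have sI := submod_idealr_closed hI.
  (* The chain starts as [mm] alone. The sequence on A/I extends it down to a prime containing I;
     the A-regular sequence in I then adds g more primes below. *)
  have chmm : prime_chain 0 (fun=> mm).
    by split=> // i _; apply: (local_prime noeAo locA).
  have [|F [chF IF]] := wregular_prime_chain noeAo sI sreg chmm smm.
    by move=> b; apply: (local_sub noeAo locA sI); case: hI => _ /negP.
  have [s' [<- s'I s'reg]] := gradeI.
  have [||F' [chF' _]] :=
    wregular_prime_chain noeAo (@zero_submod A A^o) s'reg chF.
  - by move=> a /s'I/IF.
  - by move=> _ ->; apply: IF; case: hI.
  have : ((size s + size s')%:Z%:E <= krull_dim A)%E.
    by apply: le_sup_nat; exists F'; rewrite -[size s]add0n.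
  by rewrite hd lee_fin lez_nat.
have c_le i : (i < m - g)%N -> (c <= depth mm (koszul_homology x i))%E.
  by move=> lti; rewrite hc; apply: (bigmin_le _ (Ordinal lti)).
have cH k i : ((k%:Z)%:E <= c)%E -> (i < m - g)%N ->
    depth_ge mm k (Kcyc x i) (Kbnd x i).
  move=> kc lti.
  apply/(quot_iso_depth_ge mm k (Kcyc_submod x i) (@true_submod _ _)
    (@Kbnd_Kcyc _ _ x i) (iso i)).
  by apply: depth_ge_depth => //; apply: le_trans kc (c_le i lti).
have c0 : (0%:E <= c)%E.
  by rewrite hc; apply: le_bigmin => [|i _]; [apply: leey | apply: depth_ge0].
have [k ck] : exists k : nat, c = (k%:Z)%:E.
  case: c c0 cH {hc c_le} => [z||] //= z0 cH.
    by exists `|z|%N; rewrite gez0_abs.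
  (* If c were [+oo], then H_0 = A/I would have depth at least d+1, against [le_d]; H_0 is among the
     modules in the minimum because g < m. *)
  have := le_d d.+1 (cH d.+1 0%N (leey _) mg0).
  by rewrite addSn ltnNge leq_addr.
have kgd : (k + g <= d)%N by apply: le_d; apply: cH; rewrite ?ck.
have gd : (g <= d)%N by apply: leq_trans kgd; apply: leq_addl.
have concl n : (n <= k.+1)%N -> (n + g <= d)%N ->
    ((n%:Z)%:E <= depth mm (koszul_homology x (m - g)))%E.
  move=> nk ngd.
  apply: (depth_depth_ge noeA locA (noethmod_ffun noeAo) (Kcyc_submod x _)
    (Kbnd_submod x _) (@Kbnd_Kcyc _ _ x _) (iso _)).
  apply: (koszul_depth noeA locA hx gd (ltnW hgm) depthA gradeI _ nk ngd) => i.
  by apply: cH; rewrite ck.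
rewrite ck; split=> [|]; first exact: concl.
rewrite lte_fin ltrBrDr -PoszD ltz_nat => kgd'.
by rewrite -EFinD -[1%R]/(1%:Z) -PoszD addn1; apply: concl.
Qed.
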